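(* Let $\mathbb{T}$ be a time scale that is unbounded above and has bounded graininess $\mu$, let $t_0<t_f$ be points of $\mathbb{T}$, and let $A(t)\in\mathbb{R}^{n\times n}$, $C(t)\in\mathbb{R}^{p\times n}$ be rd-continuous matrix functions on $\mathbb{T}$ with $A$ regressive. Suppose $q$ is a positive integer such that, for $t\in[t_0,t_f]$, $C(t)$ is $q$-times rd-continuously differentiable and both $\mu(t)$ and $A(t)$ are $(q-1)$-times rd-continuously differentiable. Then the regressive linear system $$x^{\Delta}(t)=A(t)x(t),\quad x(t_0)=x_0,\qquad y(t)=C(t)x(t),$$ is observable on $[t_0,t_f]$ if for some $t_c\in[t_0,t_f)$ we have $$\mathrm{rank}\begin{bmatrix}L_0(t_c)\\L_1(t_c)\\\vdots\\L_q(t_c)\end{bmatrix}=n,$$ where $$L_j(t)=\frac{\partial^j}{\Delta t^j}\left[C(t)\Phi_{A}(t,s)\right]\Big|_{s=t},\qquad j=0,1,\dots,q.$$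
   Context: A time scale $\mathbb{T}$ is a nonempty closed subset of $\mathbb{R}$, with forward jump operator $\sigma(t)=\inf\{s\in\mathbb{T}:s>t\}$ and graininess $\mu(t)=\sigma(t)-t$; $f^\Delta$ denotes the delta derivative, and $\partial^j/\Delta t^j$ the $j$-th partial delta derivative in the variable $t$. Differentiability is in the delta sense; ''$k$-times rd-continuously differentiable'' means the delta derivatives up to order $k$ exist and are rd-continuous. Intervals are understood to be intersected with $\mathbb{T}$. A function is rd-continuous if it is continuous at right-dense points of $\mathbb{T}$ and has finite left limits at left-dense points. $A$ is regressive if $I+\mu(t)A(t)$ is invertible for all $t\in\mathbb{T}$. $\Phi_A(t,s)$ is the transition matrix: the unique solution $X(t)$ of $X^\Delta(t)=A(t)X(t)$, $X(s)=I$. Equivalently, the $p\times n$ matrix functions $L_j$ are defined by $L_0(t)=C(t)$, $L_{j+1}(t)=L_j(t)A(t)+L_j^{\Delta}(t)(I+\mu(t)A(t))$. The system is observable on $[t_0,t_f]$ if any initial state $x(t_0)=x_0$ is uniquely determined by the corresponding response $y(t)$ for $t\in[t_0,t_f)$.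
   Formalization: The formal theorem additionally assumes σ^q(t_c) < t_f; without it the claim fails, e.g. on the natural numbers with t_0 = t_c = 0, t_f = 1, q = n = p = 1, A = 0, C(t) = t, where the rank is 1 but y(0) = 0 for every initial state. *)

(* Defs.v *)
From HB Require Import structures.
From mathcomp Require Import all_boot all_order all_algebra.
From mathcomp Require Import all_classical all_reals all_analysis.

Set Implicit Arguments.
Unset Strict Implicit.
Unset Printing Implicit Defensive.

Import Order.TTheory GRing.Theory Num.Theory.
Import numFieldNormedType.Exports.

Local Open Scope classical_set_scope.
Local Open Scope ring_scope.

Section TimeScale.
Variables (R : realType) (T : set R).

Definition time_scale : Prop := T !=set0 /\ closed T.

Definition unbounded_above : Prop := forall M : R, exists2 t, T t & M < t.

(* The convention [inf set0 = sup T] is not needed: the time scales considered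
   here are unbounded above, so the set below is never empty. *)
Definition sigma (t : R) : R := inf [set s | T s /\ t < s].

Definition mu (t : R) : R := sigma t - t.

Definition bounded_graininess : Prop := exists M : R, forall t, T t -> mu t <= M.

Definition right_dense (t : R) : Prop := sigma t = t.

(* t > inf T and rho t = t, where rho is the backward jump operator. *)
Definition left_dense (t : R) : Prop :=
  [set s | T s /\ s < t] !=set0 /\ sup [set s | T s /\ s < t] = t.

(* Below, S is T itself or the trace on T of an interval, and f is a function
   on S. The jump operator is that of T, but limits are taken along S: as is
   usual for C^k functions on [a, b], they are one-sided at the endpoints. *)

Definition rd_continuous (S : set R) (f : R -> R) : Prop :=
  forall t, S t ->
    (right_dense t -> f @ within S (nbhs t) --> f t) /\
    (left_dense t ->
       exists l : R, f @ within (S `&` [set s | s < t]) (nbhs t) --> l).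

Definition is_delta_derive (S : set R) (f : R -> R) (t l : R) : Prop :=
  forall e : R, 0 < e -> exists2 d : R, 0 < d &
    forall s, S s -> `|t - s| < d ->
      `|f (sigma t) - f s - l * (sigma t - s)| <= e * `|sigma t - s|.

(* [D j] is the j-th delta derivative of f on S; its values off S, which are
   unconstrained for j > 0, can only influence derivatives at an endpoint of S
   whose forward jump leaves S. *)
Definition rd_continuously_differentiable (S : set R) (k : nat) (f : R -> R)
    : Prop :=
  exists D : nat -> R -> R,
    [/\ D 0%N = f,
        forall j t, (j < k)%N -> S t -> is_delta_derive S (D j) t (D j.+1 t) &
        forall j, (j <= k)%N -> rd_continuous S (D j)].

Section Matrix.
Variables m n : nat.
Implicit Type F : R -> 'M[R]_(m, n).

Definition mx_rd_continuous (S : set R) F : Prop :=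
  forall i j, rd_continuous S (fun t => F t i j).

Definition mx_rd_continuously_differentiable (S : set R) (k : nat) F : Prop :=
  forall i j, rd_continuously_differentiable S k (fun t => F t i j).

Definition mx_is_delta_derive (S : set R) F (t : R) (L : 'M[R]_(m, n)) : Prop :=
  forall i j, is_delta_derive S (fun s => F s i j) t (L i j).

(* 0 where F has no delta derivative. *)
Definition mx_delta_derive (S : set R) F (t : R) : 'M[R]_(m, n) :=
  xget 0 [set L | mx_is_delta_derive S F t L].

Definition mx_delta_deriven (S : set R) (j : nat) F : R -> 'M[R]_(m, n) :=
  iter j (mx_delta_derive S) F.

End Matrix.

Section LinearSystem.
Variables n p : nat.
Implicit Types (A : R -> 'M[R]_n) (C : R -> 'M[R]_(p, n)).

Definition regressive A : Prop :=
  forall t, T t -> 1%:M + mu t *: A t \in unitmx.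

Definition is_solution (m : nat) A (s : R) (X0 : 'M[R]_(n, m))
    (X : R -> 'M[R]_(n, m)) : Prop :=
  X s = X0 /\ forall t, T t -> mx_is_delta_derive T X t (A t *m X t).

(* For every s in T, [Phi ^~ s] is the unique solution on T of
   X^Delta = A X, X(s) = I. *)
Definition is_transition_matrix A (Phi : R -> R -> 'M[R]_n) : Prop :=
  forall s, T s ->
    is_solution A s 1%:M (Phi ^~ s) /\
    (forall X, is_solution A s 1%:M X -> forall t, T t -> X t = Phi t s).

(* L_j(t): differentiate in the first variable s of C(s) Phi(s, t), then put
   s = t. *)
Definition obs_mx (S : set R) C (Phi : R -> R -> 'M[R]_n) (j : nat) (t : R)
    : 'M[R]_(p, n) :=
  mx_delta_deriven S j (fun s => C s *m Phi s t) t.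

(* The response is observed on [t0, tf), the right endpoint being excluded. *)
Definition observable A C (t0 tf : R) : Prop :=
  forall (x0 x0' : 'cV[R]_n) (x x' : R -> 'cV[R]_n),
    is_solution A t0 x0 x -> is_solution A t0 x0' x' ->
    (forall t, T t -> t0 <= t < tf -> C t *m x t = C t *m x' t) ->
    x0 = x0'.

End LinearSystem.
End TimeScale.

(* Main.v *)
Require Import Defs.
From mathcomp Require Import all_boot all_order all_algebra.
From mathcomp Require Import all_classical all_reals all_analysis.
From mathcomp Require Import ring.

Set Implicit Arguments.
Unset Strict Implicit.
Unset Printing Implicit Defensive.

Import Order.TTheory GRing.Theory Num.Theory.
Import numFieldNormedType.Exports.
Local Open Scope classical_set_scope.
Local Open Scope ring_scope.

(* The difference z of two solutions with the same response satisfies C z = 0 on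
   [t0, tf). Uniqueness for the transition matrix gives z(s) = Phi(s, tc) z(tc),
   so G(s) = C(s) Phi(s, tc) has G(s) z(tc) = 0 on [t0, tf). A delta derivative
   of a function vanishing at s, at sigma(s) and at points arbitrarily close to
   s vanishes at s; iterating, the j-th delta derivative of G annihilates z(tc)
   at every s with sigma^j(s) < tf, in particular at tc for j <= q. The rank
   condition then gives z(tc) = 0, whence z = 0. *)

Section JumpOperator.
Context {R : realType} {T : set R}.
Hypotheses (closedT : closed T) (unbT : unbounded_above T).
Implicit Types s t u : R.

Lemma sigma_nonempty t : [set s | T s /\ t < s] !=set0.
Proof. by have [s Ts ts] := unbT t; exists s. Qed.

Lemma sigma_has_inf t : has_inf [set s | T s /\ t < s].
Proof.
split; first exact: sigma_nonempty.
by exists t => s [_ /ltW].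
Qed.

Lemma sigma_ge t : t <= sigma T t.
Proof. by apply: lb_le_inf; [exact: sigma_nonempty|move=> s [_ /ltW]]. Qed.

Lemma sigma_le t u : T u -> t < u -> sigma T t <= u.
Proof. by move=> Tu tu; apply: ge_inf => //; exact: (sigma_has_inf t).2. Qed.

Lemma sigma_in t : T (sigma T t).
Proof.
apply: closedT => B /nbhs_ballP[e /= e0 eB].
have [u [Tu tu] ue] := inf_adherent e0 (sigma_has_inf t).
exists u; split => //; apply: eB.
rewrite /ball /= distrC ger0_norm ?subr_ge0; last exact: sigma_le.
by rewrite ltrBlDl.
Qed.

Lemma sigma_homo : {homo sigma T : t u / t <= u}.
Proof.
move=> t u tu; apply: lb_le_inf; first exact: sigma_nonempty.
by move=> s [Ts us]; apply: sigma_le => //; exact: le_lt_trans us.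
Qed.

Lemma iter_sigma_homo j : {homo iter j (sigma T) : t u / t <= u}.
Proof. by elim: j => //= j IH t u /IH; exact: sigma_homo. Qed.

Lemma iter_sigma_ge j t : t <= iter j (sigma T) t.
Proof. by elim: j => //= j IH; apply: le_trans IH _; exact: sigma_ge. Qed.

(** Supplies points arbitrarily close to a right-dense [t] whose first [j] jumps all stay below [b],
    where an inductive vanishing statement can still be applied. *)
Lemma right_dense_iter_sigma j t b : right_dense T t -> t < b ->
  exists u, [/\ T u, t < u, u < b & iter j (sigma T) u < b].
Proof.
move=> rdt; elim: j b => [|j IH] b tb.
  have [u [Tu tu] ub] : exists2 u, T u /\ t < u & u < b.
    by apply: inf_lt; [exact: sigma_nonempty|rewrite -/(sigma T t) rdt].
  by exists u.
have [u [Tu tu ub jub]] := IH _ tb.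
(* Since [w < u] are both in [T], the jump of [w] does not pass [u]; this absorbs the one extra
   iteration. *)
have [w [Tw tw wu _]] := IH _ tu.
exists w; split => //; first exact: lt_trans wu ub.
rewrite iterSr; apply: le_lt_trans jub.
by apply: iter_sigma_homo; exact: sigma_le.
Qed.

End JumpOperator.

Section DeltaDerivative.
Context {R : realType} (T S : set R).
Implicit Types (f g : R -> R) (t l : R).

Lemma is_delta_derive0 t : is_delta_derive T S (fun=> 0) t 0.
Proof.
move=> e e0; exists 1 => // s _ _.
by rewrite mul0r !subr0 normr0 mulr_ge0 // ltW.
Qed.

Lemma is_delta_deriveD f g t l1 l2 :
  is_delta_derive T S f t l1 -> is_delta_derive T S g t l2 ->
  is_delta_derive T S (fun s => f s + g s) t (l1 + l2).
Proof.
move=> df dg e e0; have e20 : 0 < e / 2 by rewrite divr_gt0.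
have [d1 d10 h1] := df _ e20; have [d2 d20 h2] := dg _ e20.
exists (Num.min d1 d2); first by rewrite lt_min d10.
move=> s Ss; rewrite lt_min => /andP[sd1 sd2].
set u := sigma T t; rewrite [e]splitr [leRHS]mulrDl.
rewrite (_ : _ - _ - _ =
  (f u - f s - l1 * (u - s)) + (g u - g s - l2 * (u - s))).
  by apply: le_trans (ler_normD _ _) _; apply: lerD; [exact: h1|exact: h2].
by ring.
Qed.

Lemma is_delta_deriveMr f t l c : is_delta_derive T S f t l ->
  is_delta_derive T S (fun s => f s * c) t (l * c).
Proof.
(* The [+ 1] keeps the divisor positive when [c = 0]. *)
move=> df e e0; have c0 : 0 < `|c| + 1 by rewrite ltr_wpDl.
have [d d0 h] := df _ (divr_gt0 e0 c0); exists d => // s Ss sd.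
rewrite [l * c * _]mulrAC -!mulrBl normrM.
apply: le_trans (ler_wpM2r (normr_ge0 c) (h _ Ss sd)) _.
rewrite mulrAC ler_wpM2r // -mulrA ger_pMr // ler_pdivrMl // mulr1.
by rewrite lerDl.
Qed.

Lemma is_delta_derive_sum (I : Type) (r : seq I) (F : I -> R -> R)
    (L : I -> R) t : (forall i, is_delta_derive T S (F i) t (L i)) ->
  is_delta_derive T S (fun s => \sum_(i <- r) F i s) t (\sum_(i <- r) L i).
Proof.
move=> dF; elim: r => [|i r IH].
  rewrite big_nil (_ : (fun=> _) = fun=> 0); last first.
    by apply/funext => s; rewrite big_nil.
  exact: is_delta_derive0.
rewrite big_cons (_ : (fun=> _) = fun s => F i s + \sum_(j <- r) F j s).
  exact: is_delta_deriveD.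
by apply/funext => s; rewrite big_cons.
Qed.

(** At such an [s] the defining estimate reads [|l| |sigma t - s| <= e |sigma t - s|], and
    [s != sigma t] allows division. *)
Lemma is_delta_derive_eq0 f t l : is_delta_derive T S f t l ->
  f (sigma T t) = 0 ->
  (forall d, 0 < d ->
     exists s, [/\ S s, `|t - s| < d, s != sigma T t & f s = 0]) ->
  l = 0.
Proof.
move=> df fst0 near0; apply/eqP; rewrite -normr_le0; apply/ler_addgt0Pl => e e0.
have [d d0 h] := df _ e0; have [s [Ss sd ns fs0]] := near0 _ d0.
rewrite addr0; have := h _ Ss sd.
rewrite fst0 fs0 subrr sub0r normrN normrM ler_pM2r //.
by rewrite normr_gt0 subr_eq0 eq_sym.
Qed.

Lemma mx_is_delta_deriveD m n (F G : R -> 'M[R]_(m, n)) t L1 L2 :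
  mx_is_delta_derive T S F t L1 -> mx_is_delta_derive T S G t L2 ->
  mx_is_delta_derive T S (fun s => F s + G s) t (L1 + L2).
Proof.
move=> dF dG i j; rewrite mxE.
rewrite (_ : (fun=> _) = fun s => F s i j + G s i j); last first.
  by apply/funext => s; rewrite mxE.
exact: is_delta_deriveD.
Qed.

Lemma mx_is_delta_derive_mulmxr m n k (F : R -> 'M[R]_(m, n))
    (B : 'M[R]_(n, k)) t L : mx_is_delta_derive T S F t L ->
  mx_is_delta_derive T S (fun s => F s *m B) t (L *m B).
Proof.
move=> dF i j; rewrite mxE.
rewrite (_ : (fun=> _) = fun s => \sum_a F s i a * B a j); last first.
  by apply/funext => s; rewrite mxE.
by apply: is_delta_derive_sum => a; exact: is_delta_deriveMr.
Qed.

End DeltaDerivative.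

(** Each differentiation at [s] looks ahead to [sigma s], so the bound on [s] loses one jump per
    derivative. *)
Lemma mx_delta_deriven_mulmx_eq0 (R : realType) (T : set R) (m n k : nat)
    (t0 tf : R) (G : R -> 'M[R]_(m, n)) (B : 'M[R]_(n, k)) :
  closed T -> unbounded_above T ->
  (forall s, T s -> t0 <= s < tf -> G s *m B = 0) ->
  forall j s, T s -> t0 <= s -> iter j (sigma T) s < tf ->
  mx_delta_deriven T (T `&` `[t0, tf]) j G s *m B = 0.
Proof.
move=> closedT unbT GB0; elim=> [|j IH] s Ts t0s sj_tf.
  by apply: GB0 => //; rewrite t0s.
rewrite /mx_delta_deriven iterS -/(mx_delta_deriven _ _ _ _) /mx_delta_derive.
(* Where no derivative exists, the default value 0 annihilates [B] trivially. *)
case: xgetP => [L _ dL|_]; last by rewrite mul0mx.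
have s_tf : s < tf := le_lt_trans (iter_sigma_ge unbT _ _) sj_tf.
have S_in u : T u -> t0 <= u -> u < tf -> (T `&` `[t0, tf]) u.
  by move=> Tu t0u utf; split; rewrite //= in_itv /= t0u ltW.
have sjs_tf : iter j (sigma T) (sigma T s) < tf by rewrite -iterSr.
apply/matrixP => a b; rewrite [RHS]mxE.
apply: (is_delta_derive_eq0 (mx_is_delta_derive_mulmxr B dL a b)).
  rewrite IH ?mxE //; first exact: sigma_in.
  exact: le_trans t0s (sigma_ge unbT s).
(* At a right-dense [s] a nearby zero to the right is needed; at a right-scattered one [s] itself
   differs from [sigma s] and serves. *)
move=> d d0; have [rds|rss] := eqVneq (sigma T s) s.
  (* The bound [tf] is for the induction hypothesis, [s + d] for closeness to [s]. *)
  have sb : s < Num.min tf (s + d) by rewrite lt_min s_tf ltrDl.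
  have [u [Tu su]] := right_dense_iter_sigma unbT j rds sb.
  rewrite !lt_min => /andP[utf usd] /andP[ju_tf _].
  have t0u : t0 <= u := le_trans t0s (ltW su).
  exists u; split; first exact: S_in.
  - by rewrite distrC gtr0_norm ?subr_gt0 // ltrBlDl.
  - by rewrite rds gt_eqF.
  - by rewrite IH ?mxE.
exists s; split; [exact: S_in|by rewrite subrr normr0|by rewrite eq_sym|].
rewrite IH ?mxE //; apply: le_lt_trans sj_tf.
by rewrite iterS; exact: sigma_ge.
Qed.

Section LinearSystem.
Context {R : realType} {T : set R} {n : nat}.
Context {A : R -> 'M[R]_n} {Phi : R -> R -> 'M[R]_n}.

Lemma is_solutionD m s X0 Y0 (X Y : R -> 'M[R]_(n, m)) :
  is_solution T A s X0 X -> is_solution T A s Y0 Y ->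
  is_solution T A s (X0 + Y0) (fun t => X t + Y t).
Proof.
move=> [<- dX] [<- dY]; split=> // t Tt; rewrite mulmxDr.
by apply: mx_is_delta_deriveD; [exact: dX|exact: dY].
Qed.

Lemma is_solution_mulmxr m k s X0 (X : R -> 'M[R]_(n, m)) (B : 'M[R]_(m, k)) :
  is_solution T A s X0 X -> is_solution T A s (X0 *m B) (fun t => X t *m B).
Proof.
move=> [<- dX]; split=> // t Tt; rewrite mulmxA.
by apply: mx_is_delta_derive_mulmxr; exact: dX.
Qed.

Lemma is_solutionB m s X0 Y0 (X Y : R -> 'M[R]_(n, m)) :
  is_solution T A s X0 X -> is_solution T A s Y0 Y ->
  is_solution T A s (X0 - Y0) (fun t => X t - Y t).
Proof.
have oppE (Z : 'M[R]_(n, m)) : - Z = Z *m (- 1%:M) by rewrite mulmxN mulmx1.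
move=> sX sY; rewrite oppE (_ : (fun=> _) = fun t => X t + Y t *m - 1%:M).
  by apply: is_solutionD => //; exact: is_solution_mulmxr.
by apply/funext => t; rewrite oppE.
Qed.

Hypothesis trPhi : is_transition_matrix T A Phi.

(* Otherwise a multiple W(t) B of a nonzero solution W vanishing at s could be
   added to Phi(t, s). *)
Lemma solution_eq0 m s (W : R -> 'M[R]_(n, m)) : T s ->
  is_solution T A s 0 W -> forall t, T t -> W t = 0.
Proof.
move=> Ts sW t Tt; have [sPhi uPhi] := trPhi Ts.
apply/matrixP => i j; rewrite [RHS]mxE.
(* Right multiplication by [delta_mx j i] moves the entry [W t i j] to position [(i, i)]. *)
have := is_solutionD sPhi (is_solution_mulmxr (delta_mx j i) sW).
rewrite mul0mx addr0 => /uPhi/(_ _ Tt)/eqP; rewrite -subr_eq0 addrC addKr.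
move=> /eqP/matrixP/(_ i i); rewrite !mxE (bigD1 j) //= big1 ?addr0.
  by rewrite mxE !eqxx mulr1.
by move=> k kj; rewrite mxE (negPf kj) mulr0.
Qed.

(** The difference of the two sides is a solution vanishing at [s]. *)
Lemma solutionE m s X0 (X : R -> 'M[R]_(n, m)) : T s ->
  is_solution T A s X0 X -> forall t, T t -> X t = Phi t s *m X0.
Proof.
move=> Ts sX t Tt; apply/eqP; rewrite -subr_eq0; apply/eqP.
apply: (@solution_eq0 _ s (fun t => X t - Phi t s *m X0)) => //.
have := is_solutionB sX (is_solution_mulmxr X0 (trPhi Ts).1).
by rewrite mul1mx subrr.
Qed.

End LinearSystem.

(* The hypothesis [iter q (sigma T) tc < tf] says that L_0(tc), ..., L_q(tc)
   only involve [t0, tf), where the response is observed. It holds whenever tf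
   is left-dense or tc is right-dense. It cannot be dropped: on the time scale
   of natural numbers take t0 = tc = 0, tf = 1, q = n = p = 1, A = 0 and
   C(t) = t, so that L_0(0) = 0 and L_1(0) = 1, whereas y(0) = 0 for all x0. *)
Theorem theorem3p4 (R : realType) (T : set R) (n p q : nat) (t0 tf tc : R)
    (A : R -> 'M[R]_n) (C : R -> 'M[R]_(p, n)) (Phi : R -> R -> 'M[R]_n) :
  time_scale T -> unbounded_above T -> bounded_graininess T ->
  T t0 -> T tf -> t0 < tf ->
  mx_rd_continuous T T A -> mx_rd_continuous T T C -> regressive T A ->
  is_transition_matrix T A Phi ->
  (0 < q)%N ->
  mx_rd_continuously_differentiable T (T `&` `[t0, tf]) q C ->
  rd_continuously_differentiable T (T `&` `[t0, tf]) q.-1 (mu T) ->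
  mx_rd_continuously_differentiable T (T `&` `[t0, tf]) q.-1 A ->
  T tc -> t0 <= tc < tf -> iter q (sigma T) tc < tf ->
  \rank (\mxcol_(j < q.+1) obs_mx T (T `&` `[t0, tf]) C Phi j tc) = n ->
  observable T A C t0 tf.
Proof.
move=> [_ closedT] unbT _ Tt0 _ _ _ _ _ trPhi _ _ _ _ Ttc /andP[t0tc _] tcq rk.
move=> x0 x0' x x' sx sx' yE; apply/eqP; rewrite -subr_eq0; apply/eqP.
have [zt0 dz] := is_solutionB sx sx'; set z := fun t => _ in zt0 dz.
have sz : is_solution T A tc (z tc) z by [].
have obs0 (j : 'I_q.+1) :
    obs_mx T (T `&` `[t0, tf]) C Phi j tc *m z tc = 0.
  apply: mx_delta_deriven_mulmx_eq0 => // [s Ts st|].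
    by rewrite -mulmxA -(solutionE trPhi Ttc sz Ts) mulmxBr yE // subrr.
  (* Jumps never decrease, so [j <= q] of them from [tc] reach no further than [q] do. *)
  apply: le_lt_trans tcq; case: j => j /= jq.
  rewrite -(subnKC (jq : (j <= q)%N)) iterD.
  by apply: iter_sigma_homo => //; exact: iter_sigma_ge.
(* Rank [n] gives the stacked matrix a left inverse [B]. *)
have /row_fullP[B BO] : row_full
    (\mxcol_(j < q.+1) obs_mx T (T `&` `[t0, tf]) C Phi j tc).
  by rewrite /row_full rk.
have ztc : z tc = 0.
  rewrite -[z tc]mul1mx -BO -mulmxA mxcol_mul.
  by under eq_mxcol do rewrite obs0; rewrite mxcol0 mulmx0.
by rewrite ztc in sz; rewrite -zt0; exact: (solution_eq0 trPhi Ttc sz Tt0).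
Qed.
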